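(* Let $(Z,\mathcal{M})$ be a complete ultrametric Möbius space. Then there exists a nonelementary geodesically complete tree $X$ such that $(\partial_\infty X,\mathcal{M}_X)$ is Möbius equivalent to $(Z,\mathcal{M})$.
   Context: **Extended metrics.** Let $Z$ be a set with $|Z|\ge 3$. An extended metric on $Z$ is a symmetric map $\rho:Z\times Z\to[0,\infty]$ such that there is a set $\Omega(\rho)\subset Z$ with $|\Omega(\rho)|\in\{0,1\}$, such that $\rho$ restricted to $Z\setminus\Omega(\rho)$ is a metric (with finite values), $\rho(z,\omega)=\infty$ for $z\in Z\setminus\Omega(\rho)$, $\omega\in\Omega(\rho)$, and $\rho(\omega,\omega)=0$ for $\omega \in\Omega(\rho)$. If $\Omega(\rho)=\{\omega\}$, $\omega$ is called the (infinitely) remote point. Write $Z_\omega=Z\setminus\Omega(\rho)$. $(Z,\rho)$ is complete if every Cauchy sequence of the metric space $Z_\omega$ converges in $Z_\omega$ and, in case $Z_\omega$ is unbounded, the remote point exists. **Cross ratio triple.** A quadruple $(x,y,z,w)\in Z^4$ is admissible if no entry occurs three or four times. Its cross ratio triple is the point $$\mathrm{crt}_\rho(x,y,z,w)=(\rho(x,y)\rho(z,w):\rho(x,z)\rho(y,w):\rho(x,w)\rho(y,z))\in\mathbb{R}P^2,$$ with the conventions: if the remote point occurs exactly once, the three (infinite) factors containing it are cancelled, e.g. $\mathrm{crt}_\rho(x,y,z,\omega)=(\rho(x,y):\rho(x,z):\rho(y,z))$; if it occurs twice, the entry in which it is paired with itself is $0$ and the other two entries are equal, e.g. $\mathrm{crt}_\rho(x,y,\omega,\omega)=(0:1:1)$.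 **Möbius spaces.** Two extended metrics on $Z$ are Möbius equivalent if they have the same cross ratio triple on all admissible quadruples. A Möbius structure $\mathcal{M}$ on $Z$ is an equivalence class of Möbius equivalent extended metrics on $Z$; a Möbius space is a pair $(Z,\mathcal{M})$ with $|Z|\ge3$. Put $\mathrm{crt}=\mathrm{crt}_\rho$ for any $\rho\in\mathcal{M}$. A map between Möbius spaces is Möbius if it is injective and preserves the cross ratio triple of all admissible quadruples; two Möbius spaces are Möbius equivalent if there is a bijective Möbius map between them. $(Z,\mathcal{M})$ is complete if $(Z,\rho)$ is complete for $\rho\in\mathcal{M}$ (this does not depend on the choice of $\rho\in\mathcal M$). A point $(a:b:c)$ with $a,b,c\ge0$ is ultrametric if the two largest of $a,b,c$ coincide; $(Z,\mathcal{M})$ is ultrametric if $\mathrm{crt}(x,y,z,w)$ is ultrametric for all admissible quadruples. **Trees.** A tree is a metric space $(X,d)$, $|xy|:=d(x,y)$, such that (1) any $x,y\in X$ are joined by a unique isometric map $c:[0,d(x,y)]\to X$ with $c(0)=x$, $c(d(x,y))=y$, with image denoted $[x,y]$; (2) if $[x,y]\cap[y,z]=\{y\}$ then $[x,z]=[x,y]\cup[y,z]$. It is geodesically complete if every isometric map $[0,\ell]\to X$, $\ell>0$, extends to an isometric map $\mathbb{R}\to X$ (isometric map means distance preserving). **Boundary.** For $x,y,o\in X$ let $(x|y)_o=\frac12(|ox|+|oy|-|xy|)$. A sequence $(x_i)$ in $X$ is a Gromov sequence if $(x_i|x_j)_o\to\infty$ as $i,j\to\infty$ (for some base point $o\in X$);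 two Gromov sequences are equivalent if $(x_i|y_i)_o\to\infty$. $\partial_\infty X$ is the set of equivalence classes. $X$ is nonelementary if $|\partial_\infty X|\ge3$. For $a\ne b$ in $\partial_\infty X$ let $(a|b)_x=\lim_i(a_i|b_i)_x$ for sequences $(a_i),(b_i)$ representing $a,b$ (well defined). The Bourdon metric at $x\in X$ is $\rho_x(a,b)=e^{-(a|b)_x}$ for $a\neq b$, $\rho_x(a,a)=0$. All $\rho_x$, $x\in X$, are Möbius equivalent ultrametrics on $\partial_\infty X$; for $X$ nonelementary, $\mathcal{M}_X$ denotes the Möbius structure on $\partial_\infty X$ containing them (the canonical Möbius structure). *)

(* Defs.v *)
From HB Require Import structures.
From mathcomp Require Import all_boot all_order all_algebra.
From mathcomp Require Import all_classical all_reals all_analysis.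

Set Implicit Arguments.
Unset Strict Implicit.
Unset Printing Implicit Defensive.

Import Order.TTheory GRing.Theory Num.Theory.
Import numFieldNormedType.Exports.

Local Open Scope classical_set_scope.
Local Open Scope ring_scope.

Definition three_points (T : Type) : Prop :=
  exists a b c : T, [/\ a <> b, b <> c & a <> c].

Section ExtendedMetrics.
Variables (R : realType) (Z : Type).
Implicit Types (rho : Z -> Z -> \bar R) (Om : set Z).

(* The set of remote points is determined by rho as soon as Z has three
   points, so that quantifying over the witness Om below is harmless. *)
Definition remote_set rho Om : Prop :=
  [/\ is_subset1 Om,
      [/\ forall x y, ~ Om x -> ~ Om y -> rho x y \is a fin_num,
          forall x y, ~ Om x -> ~ Om y -> (rho x y = 0%E <-> x = y)
        & forall x y z, ~ Om x -> ~ Om y -> ~ Om z ->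
            (rho x z <= rho x y + rho y z)%E],
      forall z w, ~ Om z -> Om w -> rho z w = +oo%E
    & forall w, Om w -> rho w w = 0%E].

Definition extended_metric rho : Prop :=
  [/\ forall x y, (0 <= rho x y)%E,
      forall x y, rho x y = rho y x
    & exists Om, remote_set rho Om].

Definition cauchy_in rho Om (u : nat -> Z) : Prop :=
  (forall n, ~ Om (u n)) /\
  forall e : R, 0 < e -> exists N, forall m n, (N <= m)%N -> (N <= n)%N ->
    (rho (u m) (u n) < e%:E)%E.

Definition converges_in rho Om (u : nat -> Z) : Prop :=
  exists2 l, ~ Om l &
  forall e : R, 0 < e -> exists N, forall n, (N <= n)%N ->
    (rho (u n) l < e%:E)%E.

Definition bounded_off rho Om : Prop :=
  exists C : R, forall x y, ~ Om x -> ~ Om y -> (rho x y <= C%:E)%E.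

Definition complete_extended_metric rho : Prop :=
  forall Om, remote_set rho Om ->
    (forall u, cauchy_in rho Om u -> converges_in rho Om u) /\
    (~ bounded_off rho Om -> Om !=set0).

End ExtendedMetrics.

Section CrossRatio.
Variable R : realType.

(* The point (a : b : c) of the projective plane, as a line in R^3. *)
Definition homog (a b c : R) : {vspace 'rV[R]_3} :=
  <[\row_(i < 3) [:: a; b; c]`_i]>%VS.

Definition ultrametric_point (p : {vspace 'rV[R]_3}) : Prop :=
  exists a b c : R, [/\ 0 <= a, 0 <= b, 0 <= c, p = homog a b c &
    [\/ a <= b /\ b = c, b <= a /\ a = c | c <= a /\ a = b]].

Definition admissible (Z : Type) (x y z w : Z) : Prop :=
  [/\ ~ (x = y /\ y = z), ~ (x = y /\ y = w),
      ~ (x = z /\ z = w) & ~ (y = z /\ z = w)].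

(* Replacing every infinite factor by 1 implements both conventions on the
   remote point: if it occurs once, each entry contains exactly one infinite
   factor, which is cancelled; if it occurs twice, two entries are products of
   two infinite factors, hence equal to 1, and the third one contains the
   distance 0 from the remote point to itself. *)
Definition crt_factor (Z : Type) (rho : Z -> Z -> \bar R) (x y : Z) : R :=
  if rho x y is +oo%E then 1 else fine (rho x y).

Definition crt (Z : Type) (rho : Z -> Z -> \bar R) (x y z w : Z) :
    {vspace 'rV[R]_3} :=
  homog (crt_factor rho x y * crt_factor rho z w)
        (crt_factor rho x z * crt_factor rho y w)
        (crt_factor rho x w * crt_factor rho y z).

End CrossRatio.

Section MoebiusSpaces.
Variable R : realType.

Definition moebius_equivalent_metrics (Z : Type) (rho rho' : Z -> Z -> \bar R) :
    Prop :=
  forall x y z w, admissible x y z w -> crt rho x y z w = crt rho' x y z w.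

Definition moebius_structure (Z : Type) (M : set (Z -> Z -> \bar R)) : Prop :=
  exists2 rho, extended_metric rho &
  M = [set rho' | extended_metric rho' /\ moebius_equivalent_metrics rho rho'].

Definition moebius_space (Z : Type) (M : set (Z -> Z -> \bar R)) : Prop :=
  three_points Z /\ moebius_structure M.

Definition complete_moebius (Z : Type) (M : set (Z -> Z -> \bar R)) : Prop :=
  forall rho, M rho -> complete_extended_metric rho.

Definition ultrametric_moebius (Z : Type) (M : set (Z -> Z -> \bar R)) : Prop :=
  forall rho, M rho -> forall x y z w, admissible x y z w ->
    ultrametric_point (crt rho x y z w).

Definition moebius_map (Z Z' : Type) (M : set (Z -> Z -> \bar R))
    (M' : set (Z' -> Z' -> \bar R)) (f : Z -> Z') : Prop :=
  injective f /\
  forall rho rho', M rho -> M' rho' -> forall x y z w, admissible x y z w ->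
    crt rho' (f x) (f y) (f z) (f w) = crt rho x y z w.

Definition moebius_equivalent (Z Z' : Type) (M : set (Z -> Z -> \bar R))
    (M' : set (Z' -> Z' -> \bar R)) : Prop :=
  exists2 f : Z -> Z', bijective f & moebius_map M M' f.

End MoebiusSpaces.

Section Trees.
Variables (R : realType) (X : metricType R).

Definition isometric_on (A : set R) (c : R -> X) : Prop :=
  forall s t, A s -> A t -> mdist (c s) (c t) = `|s - t|.

(* Only the restriction of c to [0, d(x, y)] matters. *)
Definition geodesic (x y : X) (c : R -> X) : Prop :=
  [/\ isometric_on `[0, mdist x y] c, c 0 = x & c (mdist x y) = y].

Definition segment (x y : X) : set X :=
  [set p | exists2 c, geodesic x y c & (c @` `[0, mdist x y]) p].

Definition is_tree : Prop :=
  (forall x y : X, exists2 c, geodesic x y c &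
     forall c', geodesic x y c' -> {in `[0, mdist x y], c' =1 c}) /\
  (forall x y z : X, segment x y `&` segment y z = [set y] ->
     segment x z = segment x y `|` segment y z).

Definition geodesically_complete : Prop :=
  forall (l : R) (c : R -> X), 0 < l -> isometric_on `[0, l] c ->
    exists2 g : R -> X, isometric_on setT g & {in `[0, l], g =1 c}.

Definition gromov_product (o x y : X) : R :=
  (mdist o x + mdist o y - mdist x y) / 2.

Definition gromov_sequence (u : nat -> X) : Prop :=
  exists o : X,
    (fun ij : nat * nat => gromov_product o (u ij.1) (u ij.2))
      @ filter_prod \oo \oo --> +oo.

Definition gromov_equiv (u v : nat -> X) : Prop :=
  exists o : X, (fun i => gromov_product o (u i) (v i)) @ \oo --> +oo.

Definition is_boundary_point (a : set (nat -> X)) : Prop :=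
  exists2 u, gromov_sequence u &
  a = [set v | gromov_sequence v /\ gromov_equiv u v].

Definition boundary : Type := {a : set (nat -> X) | is_boundary_point a}.

Definition nonelementary : Prop := three_points boundary.

(* The common limit of (a_i | b_i)_x over all pairs of representing sequences;
   the default value 0 is returned when there is no such limit. *)
Definition boundary_product (x : X) (a b : boundary) : R :=
  xget 0 [set l : R | forall u v, sval a u -> sval b v ->
    (fun i => gromov_product x (u i) (v i)) @ \oo --> l].

Definition bourdon_metric (x : X) (a b : boundary) : \bar R :=
  if `[< a = b >] then 0%E else (expR (- boundary_product x a b))%:E.

(* Moebius equivalence classes being disjoint, there is at most one such M when
   X is nonempty, hence in particular when X is nonelementary. *)
Definition canonical_moebius_structure (M : set (boundary -> boundary -> \bar R)) :
    Prop :=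
  moebius_structure M /\ forall x : X, M (bourdon_metric x).

End Trees.

(* Main.v *)
Require Import Defs.
From HB Require Import structures.
From mathcomp Require Import all_boot all_order all_algebra.
From mathcomp Require Import all_classical all_reals all_analysis.
From mathcomp Require Import ring lra.

Set Implicit Arguments.
Unset Strict Implicit.
Unset Printing Implicit Defensive.

Import Order.TTheory GRing.Theory Num.Theory.
Import numFieldNormedType.Exports.

Local Open Scope classical_set_scope.
Local Open Scope ring_scope.

(** Inverting a metric of the structure at a point, if necessary, provides a
    representative with a remote point om.  Off om it is a complete
    ultrametric r, and its balls form a tree: let the vertices be the balls
    (z, a) with centre z <> om and any radius a > 0, two pairs being identified
    when they have the same radius and the same underlying set, and let K p q
    be the radius of the smallest ball containing the balls p and q.  With
    h = ln a the height of a vertex, the distance is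
      D p q = 2 ln (K p q) - h p - h q:
    rise from p to the join of p and q, then descend to q.

    Everything rests on one inequality, [join_radius_cross_ratio]:
      K p q * K s t <= max (K p s * K q t) (K p t * K q s),
    which holds for balls of radius 0 (the points of Z) as well, and for om
    when the radius of a join with om is set to 1.  Its logarithm is the
    four-point condition for D, so that the tree is 0-hyperbolic; a geodesic
    0-hyperbolic space satisfies the two axioms of a tree
    ([zero_hyperbolic_is_tree]), and it is geodesically complete as soon as each
    nontrivial segment extends to a ray
    ([ray_extendable_geodesically_complete]), which it does here by
    always rising, or always descending towards the centre of a ball.

    For t = o, and divided by K o p * K o q * K o s, the inequality says that
      visual o p q = K o o * K p q / (K o p * K o q)
    satisfies the ultrametric inequality, on vertices and on points of Z alike.
    On vertices it equals exp (- (p|q)_o).  Hence each z in Z defines the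
    boundary point of the sequences u with visual o u z -> 0; completeness of
    r shows that all boundary points are of this form
    ([gromov_sequence_tends_to]), and the ultrametric inequality shows that the
    Bourdon metric at o is visual o on Z ([bourdon_metric_end_of]).  The
    denominators and the factor K o o cancel in cross ratio triples, so that
    z |-> end_of z is a Moebius bijection. *)

(** * Geodesic 0-hyperbolic spaces *)

Section ZeroHyperbolic.
Variables (R : realType) (X : metricType R).
Local Notation D := (@mdist R X).

(** The four-point condition. *)
Definition zero_hyperbolic : Prop := forall x y z w : X,
  D x y + D z w <= Num.max (D x z + D y w) (D x w + D y z).

Definition geodesic_space : Prop := forall x y : X, exists c, geodesic x y c.

(** Each segment [x, y] with x <> y is continued beyond y by an isometric ray r
    starting at y. *)
Definition ray_extendable : Prop := forall x y : X, x <> y ->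
  exists r : R -> X, [/\ r 0 = y,
    forall s t, 0 <= s -> 0 <= t -> D (r s) (r t) = `|s - t|
  & forall t, 0 <= t -> D x (r t) = D x y + t].

Hypothesis hyp : zero_hyperbolic.

Lemma zero_hyperbolicP (x y z w : X) :
  D x y + D z w <= D x z + D y w \/ D x y + D z w <= D x w + D y z.
Proof. by have := hyp x y z w; rewrite le_max => /orP. Qed.

Lemma between_unique (x y p q : X) :
  D x p + D p y = D x y -> D x q + D q y = D x y -> D x p = D x q -> p = q.
Proof.
move=> hp hq hpq; apply: mdist_positivity; apply/eqP.
rewrite eq_le mdist_ge0 andbT.
have := metric_sym p x; have := metric_sym q x.
by case: (zero_hyperbolicP p q x y); lra.
Qed.

Lemma geodesic_between (x y : X) c t : geodesic x y c -> 0 <= t <= D x y ->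
  D x (c t) = t /\ D (c t) y = D x y - t.
Proof.
move=> [ci c0 c1] /andP[t0 t1].
have i0 : `[0, D x y]%classic 0 by rewrite /= in_itv /= lexx mdist_ge0.
have i1 : `[0, D x y]%classic (D x y) by rewrite /= in_itv /= lexx mdist_ge0.
have it : `[0, D x y]%classic t by rewrite /= in_itv /= t0 t1.
split.
  by rewrite -[in LHS]c0 ci // sub0r normrN ger0_norm.
by rewrite -[in LHS]c1 ci // distrC ger0_norm // subr_ge0.
Qed.

Hypothesis geo : geodesic_space.

Lemma segmentP (x y p : X) : segment x y p <-> D x p + D p y = D x y.
Proof.
split=> [[c gc [t /=]]|h].
  rewrite in_itv /= => tP <-.
  by have [-> ->] := geodesic_between gc tP; rewrite addrC subrK.
have [c gc] := geo x y; exists c => //.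
have Dxp : 0 <= D x p <= D x y by rewrite mdist_ge0 -h lerDl mdist_ge0.
exists (D x p); first by rewrite /= in_itv.
have [h1 h2] := geodesic_between gc Dxp.
by apply: (@between_unique x y) => //; rewrite h1 h2 addrC subrK.
Qed.

Lemma segment_point (x y : X) t : 0 <= t <= D x y ->
  exists p, D x p = t /\ D p y = D x y - t.
Proof.
by move=> ht; have [c gc] := geo x y; exists (c t); exact: geodesic_between.
Qed.

Lemma zero_hyperbolic_is_tree : is_tree X.
Proof.
split=> [x y|x y z xyz].
  have [c gc] := geo x y; exists c => // c' gc' t; rewrite in_itv /= => ht.
  have [h1 h2] := geodesic_between gc ht.
  have [h1' h2'] := geodesic_between gc' ht.
  by apply: (@between_unique x y); rewrite ?h1 ?h2 ?h1' ?h2' // addrC subrK.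
have Dyxz : D x y + D y z = D x z.
  (* p is the branch point of the tripod x, y, z: the point of [x, y] at
     distance (x|z)_y from y; it also lies on [y, z]. *)
  pose g := (D x y + D y z - D x z) / 2.
  have := metric_triangle x y z; have := metric_triangle y x z.
  have := metric_triangle x z y; have := metric_sym y x; have := metric_sym z y.
  move=> e1 e2 t1 t2 t3.
  have [|p [p1 p2]] := @segment_point x y (D x y - g).
    by apply/andP; rewrite /g; split; lra.
  suff py : p = y by move: p1; rewrite py /g; lra.
  suff : (segment x y `&` segment y z) p by rewrite xyz.
  split; apply/segmentP; first by lra.
  have := metric_triangle y p z.
  have := metric_sym p y; have := metric_sym p x; have := metric_sym z x.
  by case: (zero_hyperbolicP p z y x); move: p1 p2; rewrite /g; lra.
apply/seteqP; split=> [p /segmentP xpz|p [] /segmentP h]; last 2 first.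
- apply/segmentP; have := metric_triangle x p z; have := metric_triangle p y z.
  by lra.
- apply/segmentP; have := metric_triangle x p z; have := metric_triangle x y p.
  by lra.
have [pxy|yxp] := leP (D x p) (D x y).
  left; have [|q [q1 q2]] := @segment_point x y (D x p).
    by rewrite mdist_ge0.
  suff -> : p = q by apply/segmentP; lra.
  apply: (@between_unique x z) => //.
  by have := metric_triangle x q z; have := metric_triangle q y z; lra.
right; have [|q [q1 q2]] := @segment_point y z (D x p - D x y).
  by apply/andP; have := mdist_ge0 p z; split; lra.
have := metric_triangle x q z; have := metric_triangle x y q => t1 t2.
suff -> : p = q by apply/segmentP; lra.
by apply: (@between_unique x z) => //; lra.
Qed.

(** Local-to-global principle: two geodesics that overlap along a nontrivial
    segment [p, q] concatenate to a geodesic. *)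
Lemma zero_hyperbolic_chain (a p q b : X) : p <> q ->
  D a q = D a p + D p q -> D p b = D p q + D q b ->
  D a b = D a p + D p q + D q b.
Proof.
move=> pq aq pb.
have pq0 : 0 < D p q by rewrite mdist_gt0; apply/eqP.
have := metric_triangle a p b.
have := metric_sym q p; have := metric_sym q b.
by case: (zero_hyperbolicP a q p b); lra.
Qed.

Lemma ray_extendable_geodesically_complete :
  ray_extendable -> geodesically_complete X.
Proof.
move=> ext l c l0 ci.
have cE s t : 0 <= s -> s <= t -> t <= l -> D (c s) (c t) = t - s.
  move=> s0 st tl.
  rewrite ci /= ?in_itv /= ?s0 ?tl ?(le_trans st) ?(le_trans s0) //.
  by rewrite distrC ger0_norm // subr_ge0.
have pq : c 0 <> c l.
  by move=> e; have := cE 0 l; rewrite e mdistxx; lra.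
have [rq [rq0 rqi rqD]] := ext _ _ pq.
have [rp [rp0 rpi rpD]] := ext _ _ (nesym pq).
pose g t := if t < 0 then rp (- t) else if t <= l then c t else rq (t - l).
exists g; last first.
  by move=> t; rewrite in_itv /= /g => /andP[t0 ->]; rewrite ltNge t0.
suff gle s t : s <= t -> D (g s) (g t) = t - s.
  move=> s t _ _; have [st|/ltW ts] := leP s t.
    by rewrite gle // distrC ger0_norm // subr_ge0.
  by rewrite metric_sym gle // ger0_norm // subr_ge0.
move=> st; rewrite /g.
have c0l : D (c 0) (c l) = l by rewrite cE ?subr0 // ltW.
have cl0 : D (c l) (c 0) = l by rewrite metric_sym.
have rpq u v : 0 <= u -> 0 <= v -> D (rp u) (rq v) = u + l + v.
  move=> u0 v0.
  have rp0u : D (rp u) (c 0) = u.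
    by rewrite -rp0 rpi // subr0 ger0_norm.
  have rq0v : D (c l) (rq v) = v.
    by rewrite -rq0 rqi // sub0r normrN ger0_norm.
  rewrite (@zero_hyperbolic_chain _ (c 0) (c l)) // ?rp0u ?rq0v ?c0l //.
    by rewrite metric_sym rpD // cl0 addrC.
  by rewrite rqD // c0l.
have [s0|s0] := ltP s 0; have [t0|t0] := ltP t 0.
- rewrite rpi ?oppr_ge0 ?ltW // opprK addrC ger0_norm ?subr_ge0 //.
- have [tl|tl] := leP t l.
    have rps : D (rp (- s)) (c 0) = - s.
      by rewrite -rp0 rpi ?subr0 ?ger0_norm // oppr_ge0 ltW.
    have rps' : D (rp (- s)) (c l) = l - s.
      by rewrite metric_sym rpD ?cl0 // oppr_ge0 ltW.
    have := cE 0 t; have := cE t l.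
    have := metric_triangle (rp (- s)) (c 0) (c t).
    have := metric_triangle (rp (- s)) (c t) (c l).
    by move=> h1 h2 h3 h4; move: (h3 t0 tl (lexx _)) (h4 (lexx _) t0 tl); lra.
  by rewrite rpq; lra.
- by lra.
have [tl|tl] := leP t l.
  by rewrite (le_trans st tl) cE.
have [sl|sl] := leP s l; last first.
  rewrite rqi ?subr_ge0 ?ltW // distrC ger0_norm; lra.
have tl0 : 0 <= t - l by rewrite subr_ge0 ltW.
have rqt : D (c 0) (rq (t - l)) = t by rewrite rqD // c0l addrC subrK.
have rqt' : D (c l) (rq (t - l)) = t - l.
  by rewrite -rq0 rqi // sub0r normrN ger0_norm.
have := metric_triangle (c s) (c l) (rq (t - l)).
have := metric_triangle (c 0) (c s) (rq (t - l)).
have := cE 0 s (lexx _) s0 sl; have := cE s l s0 sl (lexx _).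
by lra.
Qed.

End ZeroHyperbolic.

(** * The tree of balls of an ultrametric with a remote point *)

(** The real-valued form of an extended ultrametric with remote point om: off om
    it is an ultrametric, and the infinite distances to om are replaced by 1,
    the value that they contribute to a cross ratio triple.  The triangle
    inequality is not required, and fails in general, when om is involved. *)
Record remote_ultrametric (R : realType) (Z : Type) (r : Z -> Z -> R)
    (om : Z) : Prop := RemoteUltrametric {
  remote_ge0 : forall x y, 0 <= r x y;
  remote_sym : forall x y, r x y = r y x;
  remote_eq0 : forall x y, r x y = 0 <-> x = y;
  remote_point : forall x, x <> om -> r x om = 1;
  remote_ultra : forall x y z, x <> om -> y <> om -> z <> om ->
    r x z <= Num.max (r x y) (r y z);
  remote_proper : exists x, x <> om }.

(** The numbers a, b, c, d, e, f are the values pq, st, ps, qt, pt, qs of an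
    ultrametric on four points; only the bounds on pq and st matter. *)
Lemma ultrametric_cross_ratio (R : realDomainType) (a b c d e f : R) :
  0 <= a -> 0 <= b -> a <= c \/ a <= f -> a <= e \/ a <= d ->
  b <= c \/ b <= e -> b <= f \/ b <= d -> a * b <= c * d \/ a * b <= e * f.
Proof.
wlog ab : a b e f / a <= b => [hwlog|] a0 b0 h1 h2 h3 h4.
  have [ab|/ltW ba] := leP a b; first exact: hwlog.
  by rewrite mulrC [e * f]mulrC; apply: hwlog.
have lea x : b <= x -> a <= x by exact: le_trans.
by case: h3 => /[dup] /lea ? ?; case: h4 => /[dup] /lea ? ?;
  case: h1 => ?; case: h2 => ?; solve [left; exact: ler_pM
  | right; exact: ler_pM | rewrite [a * b]mulrC; left; exact: ler_pM
  | rewrite [a * b]mulrC; right; exact: ler_pM].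
Qed.

Section Kernel.
Variables (R : realType) (Z : Type) (r : Z -> Z -> R) (om : Z).
Hypothesis rP : remote_ultrametric r om.
Implicit Types (p q s t : Z * R).

(** A pair (z, a) with z <> om stands for the ball of centre z and radius a, and
    also for the point z itself when a = 0; any pair (om, _) stands for om.
    join_radius p q is the radius of the smallest ball containing both balls,
    with the convention of r if om occurs. *)
Definition join_radius p q : R :=
  if `[< p.1 = om >] || `[< q.1 = om >] then r p.1 q.1
  else Num.max (r p.1 q.1) (Num.max p.2 q.2).

Lemma join_radius_ge0 p q : 0 <= join_radius p q.
Proof.
by rewrite /join_radius; case: ifP => _; rewrite ?le_max !(remote_ge0 rP).
Qed.

Lemma join_radius_sym p q : join_radius p q = join_radius q p.
Proof. by rewrite /join_radius orbC (remote_sym rP) (maxC p.2). Qed.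

Lemma join_radiusE p q : p.1 <> om -> q.1 <> om ->
  join_radius p q = Num.max (r p.1 q.1) (Num.max p.2 q.2).
Proof. by move=> p1 q1; rewrite /join_radius !asboolF. Qed.

Lemma join_radius_remote p q : p.1 <> om -> q.1 = om -> join_radius p q = 1.
Proof.
by move=> p1 q1; rewrite /join_radius (asboolT q1) orbT q1 (remote_point rP).
Qed.

Lemma join_radius_remote2 p q : p.1 = om -> q.1 = om -> join_radius p q = 0.
Proof.
move=> p1 q1; rewrite /join_radius (asboolT q1) orbT p1 q1.
exact/(remote_eq0 rP).
Qed.

Lemma join_radius_ultra p s q : p.1 <> om -> s.1 <> om -> q.1 <> om ->
  join_radius p q <= Num.max (join_radius p s) (join_radius s q).
Proof.
move=> p1 s1 q1; rewrite !join_radiusE // !ge_max !le_max !lexx !orbT !andbT /=.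
by have := remote_ultra rP p1 s1 q1; rewrite le_max => /orP[] ->; rewrite ?orbT.
Qed.

Lemma join_radius_ultraP p s q : p.1 <> om -> s.1 <> om -> q.1 <> om ->
  join_radius p q <= join_radius p s \/ join_radius p q <= join_radius s q.
Proof.
by move=> p1 s1 q1; apply/orP; rewrite -le_max; exact: join_radius_ultra.
Qed.

(** The case of four balls is [ultrametric_cross_ratio]; if om occurs once, the
    inequality is the ultrametric inequality for the three other balls. *)
Lemma join_radius_cross_ratio p q s t :
  join_radius p q * join_radius s t <=
  Num.max (join_radius p s * join_radius q t)
          (join_radius p t * join_radius q s).
Proof.
have k0 := join_radius_ge0.
rewrite le_max; apply/orP.
have K1 u v : u.1 <> om -> v.1 = om ->
    (join_radius u v = 1) * (join_radius v u = 1).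
  by move=> u1 v1; rewrite (join_radius_sym v) !join_radius_remote.
have K0 u v : u.1 = om -> v.1 = om -> join_radius u v = 0.
  exact: join_radius_remote2.
have [p1|p1] := EM (p.1 = om); have [q1|q1] := EM (q.1 = om);
have [s1|s1] := EM (s.1 = om); have [t1|t1] := EM (t.1 = om).
all: rewrite ?(K0 _ _ p1 q1) ?(K0 _ _ p1 s1) ?(K0 _ _ p1 t1) ?(K0 _ _ q1 s1)
  ?(K0 _ _ q1 t1) ?(K0 _ _ s1 t1) ?(K1 _ _ q1 p1) ?(K1 _ _ p1 q1)
  ?(K1 _ _ s1 p1) ?(K1 _ _ p1 s1) ?(K1 _ _ t1 p1) ?(K1 _ _ p1 t1)
  ?(K1 _ _ q1 s1) ?(K1 _ _ s1 q1) ?(K1 _ _ q1 t1) ?(K1 _ _ t1 q1)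
  ?(K1 _ _ s1 t1) ?(K1 _ _ t1 s1) ?mul0r ?mulr0 ?mul1r ?mulr1.
all: try by left; rewrite ?mulr_ge0.
all: try by right; rewrite ?mulr_ge0.
- by rewrite (join_radius_sym q s); apply/or_comm; exact: join_radius_ultraP.
- by rewrite (join_radius_sym p s); exact: join_radius_ultraP.
- by rewrite (join_radius_sym q t); apply/or_comm; exact: join_radius_ultraP.
- by rewrite (join_radius_sym q s); exact: join_radius_ultraP.
apply: ultrametric_cross_ratio => //.
- by rewrite (join_radius_sym q s); exact: join_radius_ultraP.
- by rewrite (join_radius_sym q t); exact: join_radius_ultraP.
- by rewrite (join_radius_sym p s); exact: join_radius_ultraP.
- by rewrite (join_radius_sym q s); exact: join_radius_ultraP.
Qed.

(** A centre chosen once and for all for the ball of centre z and radius a: it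
    depends on the set of centres only.  The default value om is returned for no
    ball with z <> om and a >= 0, since z itself is a centre. *)
Definition canonical_center (z : Z) (a : R) : Z :=
  xget (om : {classic Z}) [set w : {classic Z} | w <> om /\ r z w <= a].

Lemma canonical_centerP z a : z <> om -> 0 <= a ->
  canonical_center z a <> om /\ r z (canonical_center z a) <= a.
Proof.
move=> z1 a0.
apply: (@xgetPex _ _ [set w : {classic Z} | w <> om /\ r z w <= a]).
by exists z; split=> //; have /(remote_eq0 rP) -> : z = z by [].
Qed.

Lemma canonical_center_eq z w a : z <> om -> w <> om -> r z w <= a ->
  canonical_center z a = canonical_center w a.
Proof.
move=> z1 w1 zw; congr (@xget {classic Z} om _); apply/seteqP.
split=> [x|x] /= [x1 xa]; split=> //.
  have := remote_ultra rP w1 z1 x1.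
  rewrite le_max (remote_sym rP w z) => /orP[] h.
    exact: le_trans h zw.
  exact: le_trans h xa.
by have := remote_ultra rP z1 w1 x1; rewrite le_max => /orP[] h;
  exact: le_trans h _.
Qed.

Lemma join_radius_canonical_center z a q : z <> om -> 0 <= a ->
  join_radius (canonical_center z a, a) q = join_radius (z, a) q.
Proof.
move=> z1 a0; have [c1 ca] := canonical_centerP z1 a0.
have [q1|q1] := EM (q.1 = om); first by rewrite !join_radius_remote.
have ca' : r (canonical_center z a) z <= a by rewrite (remote_sym rP).
have le_radius u v : u <> om -> v <> om -> r u v <= a ->
    join_radius (u, a) q <= join_radius (v, a) q.
  move=> u1 v1 uv; rewrite !join_radiusE //= !ge_max !le_max !lexx !orbT !andbT.
  have := remote_ultra rP u1 v1 q1; rewrite le_max => /orP[] h.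
    by rewrite (le_trans h uv) orbT.
  by rewrite h.
by apply/eqP; rewrite eq_le !le_radius.
Qed.

(** The pairs (z, a) that represent vertices of the tree: balls of positive
    radius with their chosen centre. *)
Definition tree_point (p : Z * R) : Prop :=
  [/\ p.1 <> om, 0 < p.2 & canonical_center p.1 p.2 = p.1].

(** The tree of balls.  The dependence on the proof that r is an ultrametric
    lets the distance of the tree be inferred from its type. *)
Definition ball_tree of remote_ultrametric r om := {p : Z * R | tree_point p}.
Local Notation X := (ball_tree rP).
Implicit Types x y : X.

Lemma join_radius_tree_point x p : 0 < join_radius (sval x) p.
Proof.
case: x => -[z a] /= [/= z1 a0 _].
have [p1|p1] := EM (p.1 = om); first by rewrite join_radius_remote.
by rewrite join_radiusE // !lt_max a0 orbT.
Qed.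

Lemma join_radius_tree_pointxx x : join_radius (sval x) (sval x) = (sval x).2.
Proof.
case: x => -[z a] /= [/= z1 a0 _]; rewrite join_radiusE //= maxxx.
have -> : r z z = 0 by apply/(remote_eq0 rP).
by rewrite maxEle (ltW a0).
Qed.

(** A Busemann function of the tree, for the end om: it increases towards om. *)
Definition height x : R := ln (sval x).2.

(** Height of the point where the rays from x and y towards om merge. *)
Definition join_height x y : R := ln (join_radius (sval x) (sval y)).

Lemma join_height_sym x y : join_height x y = join_height y x.
Proof. by rewrite /join_height join_radius_sym. Qed.

Lemma join_heightxx x : join_height x x = height x.
Proof. by rewrite /join_height join_radius_tree_pointxx. Qed.

Lemma le_join_height x y u v :
  join_radius (sval x) (sval y) <= join_radius (sval u) (sval v) ->
  join_height x y <= join_height u v.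
Proof.
by move=> h; rewrite /join_height ler_ln ?posrE ?join_radius_tree_point.
Qed.

Lemma join_height_ultra x y z :
  join_height x z <= Num.max (join_height x y) (join_height y z).
Proof.
case: (svalP x) (svalP y) (svalP z) => [x1 _ _] [y1 _ _] [z1 _ _].
rewrite le_max; apply/orP.
by case: (join_radius_ultraP x1 y1 z1) => /le_join_height; [left|right].
Qed.

Lemma height_le_join_height x y : height x <= join_height x y.
Proof.
have := join_height_ultra x y x.
by rewrite join_heightxx (join_height_sym y) maxxx.
Qed.

Lemma join_height_cross_ratio x y u v :
  join_height x y + join_height u v <=
  Num.max (join_height x u + join_height y v)
          (join_height x v + join_height y u).
Proof.
have k0 a b := join_radius_tree_point a (sval b).
have := join_radius_cross_ratio (sval x) (sval y) (sval u) (sval v).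
rewrite /join_height -!lnM ?posrE // !le_max => /orP[] h; apply/orP;
  [left|right];
  by rewrite ler_ln ?posrE ?mulr_gt0.
Qed.

(** Length of the path from x up to the join of x and y, and down to y. *)
Definition tree_dist x y : R := 2 * join_height x y - height x - height y.

Lemma tree_distxx x : tree_dist x x = 0.
Proof. by rewrite /tree_dist join_heightxx; lra. Qed.

Lemma tree_dist_sym x y : tree_dist x y = tree_dist y x.
Proof. by rewrite /tree_dist join_height_sym; lra. Qed.

Lemma tree_dist_triangle y x z : tree_dist x z <= tree_dist x y + tree_dist y z.
Proof.
rewrite /tree_dist; have := join_height_ultra x y z; rewrite le_max => /orP[];
have := height_le_join_height y x; have := height_le_join_height y z;
by rewrite (join_height_sym y x); lra.
Qed.

Lemma tree_dist_eq0 x y : tree_dist x y = 0 -> x = y.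
Proof.
rewrite /tree_dist => h.
have hx := height_le_join_height x y.
have := height_le_join_height y x; rewrite join_height_sym => hy.
have jx : join_height x y = height x by lra.
have hxy : height x = height y by lra.
have k0 := join_radius_tree_point x (sval y).
case: x y h hx hy jx hxy k0 => [[z a] zP] [[w b] wP] _ _ _.
case: (zP) (wP) => /= z1 a0 zc [/= w1 b0 wc].
rewrite /height /join_height /= => jx hxy k0.
have ab : a = b by apply: ln_inj.
have ka : join_radius (z, a) (w, b) = a by apply: ln_inj.
rewrite -{b}ab in b0 wc wP ka hxy k0 jx *.
have zw : z = w.
  rewrite -zc -wc; apply: canonical_center_eq => //.
  by rewrite -[leRHS]ka join_radiusE //= le_max lexx.
by apply: eq_exist; rewrite zw.
Qed.

HB.instance Definition _ := gen_eqMixin X.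
HB.instance Definition _ := gen_choiceMixin X.
HB.instance Definition _ := isMetric.Build R X tree_distxx tree_dist_eq0
  tree_dist_sym tree_dist_triangle.

Lemma mdistE x y : mdist x y = tree_dist x y.
Proof. by []. Qed.

End Kernel.

(** * The tree of balls is a geodesically complete tree *)

Section TreeGeometry.
Variables (R : realType) (Z : Type) (r : Z -> Z -> R) (om : Z).
Hypothesis rP : remote_ultrametric r om.
Local Notation X := (ball_tree rP).
Implicit Types (x y : X) (s t : R) (z : Z).

Lemma ball_tree_point z t : z <> om ->
  tree_point r om (canonical_center r om z (expR t), expR t).
Proof.
move=> z1; have [c1 ca] := canonical_centerP rP z1 (expR_ge0 t).
split=> /=; rewrite ?expR_gt0 //.
by apply: (canonical_center_eq rP) => //; rewrite (remote_sym rP).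
Qed.

(** The vertex at height t on the line from the end z to the end om. *)
Definition ball_vertex z (z1 : z <> om) t : X :=
  exist _ _ (ball_tree_point t z1).

Lemma tree_point_proper x : (sval x).1 <> om.
Proof. by case: (svalP x). Qed.

(** The vertex at height t on the line from om to the chosen centre of x, which
    passes through x. *)
Definition vertical x t : X := ball_vertex (@tree_point_proper x) t.

Lemma join_radius_ball z (z1 : z <> om) t p :
  join_radius r om (sval (ball_vertex z1 t)) p = join_radius r om (z, expR t) p.
Proof. by rewrite /= (join_radius_canonical_center rP) // expR_ge0. Qed.

Lemma height_ball z (z1 : z <> om) t : height (ball_vertex z1 t) = t.
Proof. by rewrite /height /= expRK. Qed.

Lemma ln_max (a b : R) : 0 < a -> 0 < b ->
  ln (Num.max a b) = Num.max (ln a) (ln b).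
Proof.
move=> a0 b0; have [ab|ba] := leP a b.
  by rewrite max_r // ler_ln.
by rewrite max_l // ler_ln ?posrE // ltW.
Qed.

Lemma join_height_ball z (z1 : z <> om) s t :
  join_height (ball_vertex z1 s) (ball_vertex z1 t) = Num.max s t.
Proof.
rewrite /join_height join_radius_ball (join_radius_sym rP) join_radius_ball.
rewrite (join_radius_sym rP) join_radiusE //=.
have -> : r z z = 0 by apply/(remote_eq0 rP).
rewrite (elimT max_idPr) ?le_max ?expR_ge0 //.
by rewrite ln_max ?expR_gt0 // !expRK.
Qed.

Lemma join_height_vertical x s t :
  join_height (vertical x s) (vertical x t) = Num.max s t.
Proof. exact: join_height_ball. Qed.

Lemma join_height_vertical_up x y t : height x <= t ->
  join_height (vertical x t) y = Num.max t (join_height x y).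
Proof.
case: x y => -[z a] /[dup] zP [/= z1 a0 zc] [[w b] /[dup] wP [/= w1 b0 wc]].
rewrite /height /join_height join_radius_ball /= => at_.
have le_at : a <= expR t by rewrite -[a]lnK ?posrE // ler_expR.
rewrite -[t in RHS]expRK -ln_max ?expR_gt0 //; last first.
  by rewrite join_radiusE //= !lt_max a0 orbT.
rewrite !join_radiusE //= !maxA ![Num.max _ (r z w)]maxC -!maxA.
by congr (ln (Num.max _ _)); rewrite !maxA (max_l le_at).
Qed.

Lemma vertical_height x : vertical x (height x) = x.
Proof.
apply: tree_dist_eq0; rewrite /tree_dist join_height_vertical_up //.
by rewrite join_heightxx height_ball maxxx; lra.
Qed.

Lemma join_height_vertical_down x y t :
  t <= height x -> height x < join_height x y ->
  join_height (vertical x t) y = join_height x y.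
Proof.
move=> tx xy.
have vx : join_height (vertical x t) x = height x.
  have := join_height_vertical x t (height x).
  by rewrite vertical_height max_r.
apply/eqP; rewrite eq_le.
have := join_height_ultra (vertical x t) x y.
rewrite vx (max_r (ltW xy)) => -> /=.
have := join_height_ultra x (vertical x t) y.
by rewrite (join_height_sym x (vertical x t)) vx le_max leNgt xy.
Qed.

Lemma mdist_vertical x s t : mdist (vertical x s) (vertical x t) = `|s - t|.
Proof.
rewrite mdistE /tree_dist join_height_vertical !height_ball.
by case: ltrP; lra.
Qed.

Lemma ball_tree_zero_hyperbolic : zero_hyperbolic X.
Proof.
move=> x y u v; rewrite !mdistE /tree_dist le_max.
have := join_height_cross_ratio x y u v.
by rewrite le_max => /orP[] h; apply/orP; [left|right]; lra.
Qed.

Lemma ball_tree_geodesic_space : geodesic_space X.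
Proof.
move=> x y; set j := join_height x y.
have dE : mdist x y = 2 * j - height x - height y by [].
have xj : height x <= j by exact: height_le_join_height.
have yj : height y <= j by rewrite /j join_height_sym height_le_join_height.
(* Rise from x for a time j - height x, then descend along the line of y. *)
pose c t := if t <= j - height x then vertical x (height x + t)
  else vertical y (height y + mdist x y - t).
have mixed s t : 0 <= s <= j - height x -> j - height x < t <= mdist x y ->
    mdist (c s) (c t) = t - s.
  move=> /andP[s0 sj] /andP[jt td]; rewrite /c sj leNgt jt /=.
  rewrite mdistE /tree_dist join_height_vertical_up ?lerDl // join_height_sym.
  rewrite join_height_vertical_up; last by lra.
  have tj : height y + mdist x y - t <= j by lra.
  have sj' : height x + s <= j by lra.
  by rewrite (join_height_sym y) -/j !height_ball (max_r tj) (max_r sj'); lra.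
exists c; split; last 2 first.
- by rewrite /c subr_ge0 xj addr0 vertical_height.
- rewrite /c; case: leP => [h|_]; last by rewrite addrK vertical_height.
  have yj' : height y = j by lra.
  have -> : height x + mdist x y = height y by lra.
  apply: tree_dist_eq0; rewrite /tree_dist join_height_vertical_up; last by lra.
  by rewrite -/j height_ball max_l; lra.
move=> s t; rewrite /= !in_itv /= => /andP[s0 sd] /andP[t0 td].
have [sj|js] := leP s (j - height x); have [tj|jt] := leP t (j - height x).
- by rewrite /c sj tj mdist_vertical; congr `|_|; lra.
- rewrite mixed ?s0 ?jt // distrC ger0_norm //; lra.
- rewrite metric_sym mixed ?t0 ?js // ger0_norm //; lra.
- rewrite /c !leNgt js jt /= mdist_vertical distrC; congr `|_|; lra.
Qed.

Lemma ball_tree_ray_extendable : ray_extendable X.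
Proof.
move=> x y xy.
(* If y lies above x, the ray rises; otherwise it descends from y. *)
have [yj|jy] := ltP (height y) (join_height x y).
  exists (fun t => vertical y (height y - t)); split=> [|s t _ _|t t0].
  - by rewrite subr0 vertical_height.
  - by rewrite mdist_vertical distrC; congr `|_|; lra.
  - rewrite !mdistE /tree_dist (join_height_sym x) join_height_vertical_down.
    + by rewrite height_ball (join_height_sym x); lra.
    + by lra.
    + by rewrite join_height_sym.
exists (fun t => vertical y (height y + t)); split=> [|s t _ _|t t0].
- by rewrite addr0 vertical_height.
- by rewrite mdist_vertical; congr `|_|; lra.
- rewrite !mdistE /tree_dist (join_height_sym x) join_height_vertical_up;
    last by lra.
  have := height_le_join_height y x.
  rewrite (join_height_sym y) height_ball => h.
  by rewrite max_l; lra.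
Qed.

End TreeGeometry.

(** * Gromov products and the visual ultrametric *)

Section GromovProducts.
Variables (R : realType) (X : metricType R).
Implicit Types (o x y : X) (u v : nat -> X).

Lemma gromov_product_base o b x y :
  gromov_product b x y - mdist o b <= gromov_product o x y.
Proof.
rewrite /gromov_product; have := metric_triangle b o x.
by have := metric_triangle b o y; rewrite (metric_sym b o); lra.
Qed.

Lemma gromov_sequenceP o u : gromov_sequence u <-> forall A : R, exists N,
  forall m n, (N <= m)%N -> (N <= n)%N -> A <= gromov_product o (u m) (u n).
Proof.
split=> [ [b /cvgryPge cu] A|cu].
  have [ [P Q] [ [N1 _ PN] [N2 _ QN]] PQ] := cu (A + mdist o b).
  exists (maxn N1 N2) => m n; rewrite !geq_max => /andP[m1 m2] /andP[n1 n2].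
  have /= := PQ (m, n) (conj (PN _ m1) (QN _ n2)).
  by have := gromov_product_base o b (u m) (u n); lra.
exists o; apply/cvgryPge => A; have [N NP] := cu A.
exists ([set n | (N <= n)%N], [set n | (N <= n)%N]) => /=.
  by split; exists N.
by move=> [m n] /= [Nm Nn]; exact: NP.
Qed.

Lemma gromov_equivP o u v : gromov_equiv u v <-> forall A : R, exists N,
  forall n, (N <= n)%N -> A <= gromov_product o (u n) (v n).
Proof.
split=> [ [b /cvgryPge cu] A|cu].
  have [N _ NP] := cu (A + mdist o b); exists N => n /NP /=.
  by have := gromov_product_base o b (u n) (v n); lra.
by exists o; apply/cvgryPge => A; have [N NP] := cu A; exists N.
Qed.

End GromovProducts.

Section Visual.
Variables (R : realType) (Z : Type) (r : Z -> Z -> R) (om : Z).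
Hypothesis rP : remote_ultrametric r om.
Local Notation X := (ball_tree rP).
Local Notation K := (join_radius r om).
Implicit Types (o x y : X) (p q s : Z * R) (u v : nat -> X) (z w : Z).

(** The function exp (- (p|q)_o), extended from vertices to all pairs, hence to
    the points (z, 0) and (om, 0) of Z. *)
Definition visual o p q : R :=
  (sval o).2 * K p q / (K (sval o) p * K (sval o) q).

Lemma radius_gt0 o : 0 < (sval o).2.
Proof. by case: (svalP o). Qed.

Lemma radius_le o p : p.1 <> om -> (sval o).2 <= K (sval o) p.
Proof.
move=> p1; rewrite join_radiusE ?le_max ?lexx ?orbT //.
exact: tree_point_proper.
Qed.

Lemma visual_ge0 o p q : 0 <= visual o p q.
Proof.
rewrite /visual divr_ge0 // mulr_ge0 ?(ltW (radius_gt0 _)) //;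
by rewrite ?(join_radius_ge0 rP).
Qed.

Lemma visual_sym o p q : visual o p q = visual o q p.
Proof. by rewrite /visual (join_radius_sym rP p) [X in _ / X]mulrC. Qed.

(** This is the cross ratio inequality for p, q, s and o. *)
Lemma visual_ultra o p s q :
  visual o p q <= Num.max (visual o p s) (visual o s q).
Proof.
have k0 t : 0 < K (sval o) t := join_radius_tree_point o t.
pose A := (sval o).2 / (K (sval o) p * K (sval o) q * K (sval o) s).
have A0 : 0 < A by rewrite divr_gt0 ?radius_gt0 // !mulr_gt0.
have vE a d c : A = (sval o).2 / (K (sval o) a * K (sval o) d * K (sval o) c) ->
    visual o a d = A * (K a d * K c (sval o)).
  move=> ->; rewrite /visual (join_radius_sym rP c).
  by field; rewrite !gt_eqF.
rewrite (vE p q s) // (vE p s q); last by congr (_ / _); ring.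
rewrite (vE s q p); last by congr (_ / _); ring.
have := join_radius_cross_ratio rP p q s (sval o).
by rewrite (join_radius_sym rP s q) [_ * K q s]mulrC !le_max !ler_pM2l.
Qed.

Lemma visual_gromov o x y :
  expR (- gromov_product o x y) = visual o (sval x) (sval y).
Proof.
have -> : - gromov_product o x y =
    height o + join_height x y - (join_height o x + join_height o y).
  by rewrite /gromov_product !mdistE /tree_dist; lra.
rewrite expRD expRN !expRD /height /join_height !lnK ?posrE ?radius_gt0 //;
  exact: join_radius_tree_point.
Qed.

Lemma visual_lt_gromov o x y e : 0 < e ->
  (visual o (sval x) (sval y) < e) = (- ln e < gromov_product o x y).
Proof.
by move=> e0; rewrite -visual_gromov -[e in LHS]lnK // ltr_expR ltrNl.
Qed.

Lemma gromov_sequence_visual o u : gromov_sequence u <->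
  forall e, 0 < e -> exists N, forall m n, (N <= m)%N -> (N <= n)%N ->
    visual o (sval (u m)) (sval (u n)) < e.
Proof.
rewrite (gromov_sequenceP o); split=> [h e e0|h A].
  have [N NP] := h (1 - ln e); exists N => m n Nm Nn.
  by rewrite visual_lt_gromov //; have := NP m n Nm Nn; lra.
have [N NP] := h _ (expR_gt0 (- A)); exists N => m n Nm Nn.
have := NP m n Nm Nn; rewrite visual_lt_gromov ?expR_gt0 // expRK opprK.
exact: ltW.
Qed.

Lemma gromov_equiv_visual o u v : gromov_equiv u v <->
  forall e, 0 < e -> exists N, forall n, (N <= n)%N ->
    visual o (sval (u n)) (sval (v n)) < e.
Proof.
rewrite (gromov_equivP o); split=> [h e e0|h A].
  have [N NP] := h (1 - ln e); exists N => n Nn.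
  by rewrite visual_lt_gromov //; have := NP n Nn; lra.
have [N NP] := h _ (expR_gt0 (- A)); exists N => n Nn.
have := NP n Nn; rewrite visual_lt_gromov ?expR_gt0 // expRK opprK.
exact: ltW.
Qed.

(** The sequence of vertices u tends to the end z of the tree. *)
Definition tends_to o u z : Prop := forall e, 0 < e ->
  exists N, forall n, (N <= n)%N -> visual o (sval (u n)) (z, 0) < e.

(** A change of base point increases the visual ultrametric by at most a
    constant factor. *)
Lemma visual_base o b : exists2 c, 0 < c &
  forall p q, visual b p q <= c * visual o p q.
Proof.
have a0 := radius_gt0 o; have a0' := radius_gt0 b.
have k0 x p : 0 < K (sval x) p := join_radius_tree_point x p.
pose c := K (sval o) (sval b) / (sval b).2.
have c0 : 0 < c by rewrite divr_gt0.
have c1 : 1 <= c.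
  rewrite ler_pdivlMr // mul1r (join_radius_sym rP) radius_le //.
  exact: tree_point_proper.
have kc p : K (sval o) p <= c * K (sval b) p.
  have [p1|p1] := EM (p.1 = om).
    by rewrite !join_radius_remote ?mulr1 //; exact: tree_point_proper.
  have := join_radius_ultra rP (@tree_point_proper _ _ _ _ _ o)
     (@tree_point_proper _ _ _ _ _ b) p1.
  rewrite le_max => /orP[] h; apply: (le_trans h).
    by rewrite /c mulrAC ler_pdivlMr // ler_pM2l // radius_le.
  by rewrite ler_peMl // ltW.
exists ((sval b).2 / (sval o).2 * (c * c)).
  by apply: mulr_gt0; [exact: divr_gt0|exact: mulr_gt0].
move=> p q; rewrite /visual.
have -> : (sval b).2 / (sval o).2 * (c * c) *
   ((sval o).2 * K p q / (K (sval o) p * K (sval o) q)) =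
   (sval b).2 * K p q * (c * c / (K (sval o) p * K (sval o) q)).
  by field; rewrite !gt_eqF.
rewrite ler_wpM2l ?mulr_ge0 ?(ltW a0') ?(join_radius_ge0 rP) //.
rewrite ler_pdivlMr ?mulr_gt0 // mulrC ler_pdivrMr ?mulr_gt0 //.
by rewrite mulrACA ler_pM // ltW.
Qed.

Lemma tends_to_base o b u z : tends_to o u z -> tends_to b u z.
Proof.
move=> uz e e0; have [c c0 cP] := visual_base o b.
have [N NP] := uz (e / c) (divr_gt0 e0 c0); exists N => n /NP.
by rewrite ltr_pdivlMr // mulrC; apply: le_lt_trans.
Qed.

End Visual.

(** * The ends of the tree of balls *)

(** Every Cauchy sequence off the remote point converges off it. *)
Definition remote_complete (R : realType) (Z : Type) (r : Z -> Z -> R)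
    (om : Z) : Prop :=
  forall u : nat -> Z, (forall n, u n <> om) ->
  (forall e, 0 < e -> exists N, forall m n, (N <= m)%N -> (N <= n)%N ->
    r (u m) (u n) < e) ->
  exists2 l, l <> om & forall e, 0 < e -> exists N, forall n, (N <= n)%N ->
    r (u n) l < e.

Section Ends.
Variables (R : realType) (Z : Type) (r : Z -> Z -> R) (om : Z).
Hypothesis rP : remote_ultrametric r om.
Hypothesis rC : remote_complete r om.
Local Notation X := (ball_tree rP).
Local Notation K := (join_radius r om).
Implicit Types (o x y : X) (p q s : Z * R) (u v : nat -> X) (z w : Z).

Let K_gt0 o p : 0 < K (sval o) p := join_radius_tree_point o p.

(** Let k n be the radius of the join of o and u n.  If k tends to infinity,
    u tends to om.  Otherwise k is bounded along a subsequence, hence eventually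
    bounded; then the radii of the joins of u m and u n tend to 0, the centres
    form a Cauchy sequence, and u tends to its limit. *)
Lemma gromov_sequence_tends_to o u : gromov_sequence u ->
  exists z, tends_to o u z.
Proof.
move=> /(gromov_sequence_visual o) uG; have a0 := radius_gt0 o.
have [uinf|] := EM (forall C, exists N, forall n, (N <= n)%N ->
    C < K (sval o) (sval (u n))).
  exists om => e e0; have [N NP] := uinf ((sval o).2 / e).
  exists N => n /NP.
  rewrite /visual !(@join_radius_remote _ _ r om rP _ (om, 0)) //;
    try exact: tree_point_proper.
  by rewrite !mulr1 ltr_pdivrMr // ltr_pdivrMr // mulrC.
move=> /existsNP[C /forallNP uC].
have {uC} uC N : exists2 n, (N <= n)%N & K (sval o) (sval (u n)) <= C.
  have /existsNP[n /not_implyP[Nn]] := uC N.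
  by move=> /negP; rewrite -leNgt; exists n.
have C0 : 0 < C by have [n _] := uC 0; exact: lt_le_trans.
(* With this threshold, for m, n >= N, K (u m) (u n) < K o (u n) as soon as
   K o (u m) <= C, and then K o (u n) <= K o (u m) by the ultrametric
   inequality. *)
have [N NP] := uG ((sval o).2 / C) (divr_gt0 a0 C0).
have {}uC n : (N <= n)%N -> K (sval o) (sval (u n)) <= C.
  have [m Nm mC] := uC N; move=> Nn.
  have := join_radius_ultra rP (@tree_point_proper _ _ _ _ _ o)
    (@tree_point_proper _ _ _ _ _ (u m)) (@tree_point_proper _ _ _ _ _ (u n)).
  rewrite le_max => /orP[] h; apply: (le_trans _ mC) => //.
  have := NP m n Nm Nn; rewrite /visual ltr_pdivrMr ?mulr_gt0 //.
  rewrite -[_ / C * _]mulrA ltr_pM2l // ltr_pdivlMl // => lt1.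
  have := lt_le_trans (le_lt_trans (ler_wpM2l (ltW C0) h) lt1)
    (ler_wpM2r (ltW (K_gt0 _ _)) mC).
  by rewrite ltxx.
have kC e : 0 < e -> exists N, forall m n, (N <= m)%N -> (N <= n)%N ->
    K (sval (u m)) (sval (u n)) < e.
  move=> e0; have eC : 0 < e * (sval o).2 / (C * C).
    by rewrite divr_gt0 ?mulr_gt0.
  have [M MP] := uG _ eC.
  exists (maxn N M) => m n; rewrite !geq_max => /andP[Nm Mm] /andP[Nn Mn].
  have := MP m n Mm Mn; rewrite /visual ltr_pdivrMr ?mulr_gt0 // mulrC => lt1.
  rewrite -(ltr_pM2r a0); apply: (lt_le_trans lt1).
  rewrite -[leRHS](@mulfVK _ (C * C)) ?gt_eqF ?mulr_gt0 //.
  rewrite ler_wpM2l ?divr_ge0 ?mulr_ge0 ?(ltW e0) ?(ltW a0) ?(ltW C0) //.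
  by apply: ler_pM; rewrite ?uC // ltW.
have [||l l1 lP] := rC (u := fun n => (sval (u n)).1).
- by move=> n; exact: tree_point_proper.
- move=> e /kC[M MP]; exists M => m n Mm Mn; apply: le_lt_trans (MP m n Mm Mn).
  by rewrite join_radiusE ?le_max ?lexx //; exact: tree_point_proper.
exists l => e e0; have ea0 := mulr_gt0 e0 a0.
have [M1 M1P] := kC _ ea0; have [M2 M2P] := lP _ ea0.
exists (maxn M1 M2) => n; rewrite geq_max => /andP[n1 n2].
have kul : K (sval (u n)) (l, 0) < e * (sval o).2.
  rewrite join_radiusE //; last exact: tree_point_proper.
  rewrite !gt_max M2P //= ea0 andbT; apply: le_lt_trans (M1P n n n1 n1).
  exact/radius_le/tree_point_proper.
rewrite /visual ltr_pdivrMr ?mulr_gt0 //.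
have := ler_pM (ltW a0) (ltW a0)
  (radius_le o (@tree_point_proper _ _ _ _ _ (u n)))
  (radius_le o (p := (l, 0)) l1).
move=> /(ler_wpM2l (ltW e0)); apply: lt_le_trans.
by rewrite mulrC mulrA ltr_pM2r.
Qed.

Lemma tends_to_exists o z : exists u, tends_to o u z.
Proof.
have large A : exists N : nat, forall n, (N <= n)%N -> A < n%:R :> R.
  exists (Num.trunc `|A|).+1 => n; rewrite -(ler_nat R); apply: lt_le_trans.
  by apply: le_lt_trans (ler_norm _) _; rewrite truncnS_gt.
have a0 := radius_gt0 o.
have [->|z1] := EM (z = om).
  exists (fun n => vertical o n%:R) => e e0.
  have [N NP] := large (ln ((sval o).2 / e)); exists N => n /NP.
  rewrite /visual !(@join_radius_remote _ _ r om rP _ (om, 0)) //;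
    try exact: tree_point_proper.
  rewrite -ltr_expR lnK ?posrE ?divr_gt0 // !mulr1 => h.
  rewrite ltr_pdivrMr // -ltr_pdivrMl // mulrC; apply: (lt_le_trans h).
  rewrite (join_radius_sym rP); apply: (radius_le (vertical o n%:R)).
  exact: tree_point_proper.
exists (fun n => ball_vertex rP z1 (- n%:R)) => e e0.
have [N NP] := large (- ln (e * (sval o).2)); exists N => n /NP.
rewrite ltrNl => lt1.
have h : expR (- n%:R) < e * (sval o).2.
  by rewrite -[ltRHS]lnK ?posrE ?mulr_gt0 // ltr_expR.
rewrite /visual join_radius_ball.
have -> : K (z, expR (- n%:R)) (z, 0) = expR (- n%:R).
  rewrite join_radiusE //= (max_l (expR_ge0 _)); apply/max_idPr.
  by have -> : r z z = 0 by apply/(remote_eq0 rP).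
rewrite ltr_pdivrMr ?mulr_gt0 // mulrC.
have := ler_pM (ltW a0) (ltW a0)
  (radius_le o (@tree_point_proper _ _ _ _ _ (ball_vertex rP z1 (- n%:R))))
  (radius_le o (p := (z, 0)) z1).
move=> /(ler_wpM2l (ltW e0)); apply: lt_le_trans.
by rewrite mulrA ltr_pM2r.
Qed.

Lemma tends_to_visual_small o u v z : tends_to o u z -> tends_to o v z ->
  forall e, 0 < e -> exists N, forall m n, (N <= m)%N -> (N <= n)%N ->
    visual o (sval (u m)) (sval (v n)) < e.
Proof.
move=> uz vz e e0; have [N NP] := uz e e0; have [M MP] := vz e e0.
exists (maxn N M) => m n; rewrite !geq_max => /andP[Nm _] /andP[_ Mn].
apply: (le_lt_trans (visual_ultra o _ (z, 0) _)).
by rewrite gt_max NP // visual_sym // MP.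
Qed.

(** In an ultrametric space, distances between convergent sequences with
    different limits are eventually constant. *)
Lemma tends_to_visual o u v z w : tends_to o u z -> tends_to o v w ->
  0 < visual o (z, 0) (w, 0) ->
  exists N, forall n, (N <= n)%N ->
    visual o (sval (u n)) (sval (v n)) = visual o (z, 0) (w, 0).
Proof.
move=> uz vw zw; have [N NP] := uz _ zw; have [M MP] := vw _ zw.
exists (maxn N M) => n; rewrite geq_max => /andP[/NP lt1 /MP lt2].
apply/eqP; rewrite eq_le; apply/andP; split.
  apply: (le_trans (visual_ultra o _ (z, 0) _)).
  rewrite ge_max (ltW lt1) /=.
  apply: (le_trans (visual_ultra o _ (w, 0) _)).
  by rewrite ge_max lexx /= visual_sym // ltW.
rewrite leNgt; apply/negP => lt3.
have := visual_ultra o (z, 0) (sval (u n)) (w, 0).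
rewrite leNgt gt_max visual_sym // lt1 /= => /negP; apply.
by apply: (le_lt_trans (visual_ultra o _ (sval (v n)) _)); rewrite gt_max lt3.
Qed.

Lemma join_radius_ends z w : K (z, 0) (w, 0) = r z w.
Proof.
rewrite /join_radius; case: ifP => // _.
by rewrite maxxx max_l //; exact: remote_ge0 rP _ _.
Qed.

Lemma visual_eq0 o z w : visual o (z, 0) (w, 0) = 0 <-> z = w.
Proof.
rewrite -(remote_eq0 rP) -join_radius_ends /visual.
split=> [/eqP|->]; last by rewrite mulr0 mul0r.
rewrite !(mulf_eq0, invr_eq0) !(gt_eqF (K_gt0 _ _)) gt_eqF ?radius_gt0 //=.
by rewrite !orbF => /eqP.
Qed.

End Ends.

(** * Homogeneous coordinates *)

Section Homogeneous.
Variable R : realType.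

Lemma homogP (a b c a' b' c' : R) : homog a b c = homog a' b' c' ->
  exists k, [/\ a = k * a', b = k * b' & c = k * c'].
Proof.
move=> e; have : \row_(i < 3) [:: a; b; c]`_i \in homog a' b' c'.
  by rewrite -e memv_line.
move=> /vlineP[k /rowP h]; exists k.
split.
- by have := h 0; rewrite !mxE.
- by have := h 1; rewrite !mxE.
- by have := h (2%:R); rewrite !mxE.
Qed.

Lemma homogZ (k a b c : R) : k != 0 ->
  homog (k * a) (k * b) (k * c) = homog a b c.
Proof.
move=> k0; rewrite /homog.
have -> : \row_(i < 3) [:: k * a; k * b; k * c]`_i =
    k *: \row_(i < 3) [:: a; b; c]`_i.
  apply/rowP => i; rewrite !mxE.
  by case: i => [] [|[|[|]]].
apply/eqP; rewrite eqEsubv -!memvE memvZ ?memv_line //=.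
by rewrite -[X in X \in _](scalerK k0) memvZ // memv_line.
Qed.

Lemma ultrametric_point_le (a b c : R) : 0 <= a -> 0 <= b -> 0 <= c ->
  ultrametric_point (homog a b c) -> b <= Num.max a c.
Proof.
move=> a0 b0 c0 [x [y [z [x0 y0 z0 /homogP[k [ae be ce]]]]]].
(* A negative factor k forces b <= 0. *)
have [k0|k0] := leP 0 k.
  rewrite ae be ce le_max => -[] [h1 h2].
  - by rewrite h2 lexx orbT.
  - by rewrite ler_wpM2l // h2.
  - by rewrite -h2 lexx.
have : b <= 0 by rewrite be mulr_le0_ge0 // ltW.
by move=> b0' _; rewrite le_max (le_trans b0' a0).
Qed.

End Homogeneous.

(** * The boundary of the tree of balls *)

Section Boundary.
Variables (R : realType) (Z : Type) (r : Z -> Z -> R) (om : Z).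
Hypothesis rP : remote_ultrametric r om.
Hypothesis rC : remote_complete r om.
Local Notation X := (ball_tree rP).
Local Notation K := (join_radius r om).
Implicit Types (o : X) (u v : nat -> X) (z w : Z).

Lemma ball_tree_inhabited : inhabited X.
Proof.
by have [z z1] := remote_proper rP; split; exact: (ball_vertex rP z1 0).
Qed.

(** The sequences of vertices tending to z; by [end_classE] it suffices to test
    a single base point. *)
Definition end_class z : set (nat -> X) := [set u | forall o, tends_to o u z].

Lemma end_classE o z u : end_class z u <-> tends_to o u z.
Proof. by split=> [|h b]; [exact|exact: tends_to_base h]. Qed.

Lemma end_class_eq o u z : tends_to o u z ->
  end_class z = [set v | gromov_sequence v /\ gromov_equiv u v].
Proof.
move=> uz; apply/seteqP; split=> v /=.
  move=> /(end_classE o) vz; split.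
    by apply/(gromov_sequence_visual o); exact: (tends_to_visual_small vz vz).
  apply/(gromov_equiv_visual o) => e e0.
  by have [N NP] := tends_to_visual_small uz vz e0; exists N => n Nn; exact: NP.
move=> [_ /(gromov_equiv_visual o) uv]; apply/(end_classE o) => e e0.
have [N NP] := uv e e0; have [M MP] := uz e e0.
exists (maxn N M) => n; rewrite geq_max => /andP[/NP lt1 /MP lt2].
apply: (le_lt_trans (visual_ultra o _ (sval (u n)) _)).
by rewrite gt_max visual_sym // lt1.
Qed.

Lemma end_class_boundary_point z : is_boundary_point (end_class z).
Proof.
case: ball_tree_inhabited => o; have [u uz] := tends_to_exists o z.
exists u; last exact: end_class_eq uz.
have : end_class z u by apply/(end_classE o).
by rewrite (end_class_eq uz) => -[].
Qed.

(** The boundary point of the tree defined by z. *)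
Definition end_of z : boundary X := exist _ _ (end_class_boundary_point z).

Lemma end_of_tends_to o z u : sval (end_of z) u <-> tends_to o u z.
Proof. exact: end_classE. Qed.

Lemma end_of_inj : injective end_of.
Proof.
move=> z w zw; case: ball_tree_inhabited => o.
have [u uz] := tends_to_exists o z.
have uw : tends_to o u w.
  by apply/end_of_tends_to; rewrite -zw; apply/(end_of_tends_to o).
apply/(visual_eq0 o)/eqP; rewrite eq_le visual_ge0 andbT.
apply/ler_addgt0Pl => e e0; rewrite addr0.
have [N NP] := uz _ e0; have [M MP] := uw _ e0.
apply: (le_trans (visual_ultra o _ (sval (u (maxn N M))) _)).
rewrite ge_max [visual _ (z, 0) _]visual_sym (ltW (NP _ (leq_maxl _ _))).
exact: ltW (MP _ (leq_maxr _ _)).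
Qed.

Lemma end_of_surj (b : boundary X) : exists z, end_of z = b.
Proof.
case: ball_tree_inhabited => o.
case: b => A Ab; have [u uG Au] := Ab.
have [z uz] := gromov_sequence_tends_to rC o uG.
by exists z; apply: eq_exist; rewrite Au; exact: end_class_eq uz.
Qed.

Lemma visual_gt0 o z w : z <> w -> 0 < visual o (z, 0) (w, 0).
Proof.
move=> zw; rewrite lt_neqAle visual_ge0 andbT eq_sym.
by apply/eqP => /(visual_eq0 o).
Qed.

Lemma boundary_product_end_of o z w : z <> w ->
  boundary_product o (end_of z) (end_of w) = - ln (visual o (z, 0) (w, 0)).
Proof.
move=> zw; have zw0 := visual_gt0 o zw.
have lim u v : sval (end_of z) u -> sval (end_of w) v ->
    (fun i => gromov_product o (u i) (v i)) @ \oo -->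
    - ln (visual o (z, 0) (w, 0)).
  move=> /(end_of_tends_to o) uz /(end_of_tends_to o) vw.
  apply: cvg_near_cst; have [N NP] := tends_to_visual uz vw zw0.
  by exists N => // n /NP <-; rewrite -visual_gromov expRK opprK.
apply: xget_unique => // l lP.
have [u uz] := tends_to_exists o z; have [v vw] := tends_to_exists o w.
have uz' : sval (end_of z) u by apply/(end_of_tends_to o).
have vw' : sval (end_of w) v by apply/(end_of_tends_to o).
exact: (cvg_unique _ (lP u v uz' vw') (lim u v uz' vw')).
Qed.

Lemma bourdon_metric_end_of o z w :
  bourdon_metric o (end_of z) (end_of w) = (visual o (z, 0) (w, 0))%:E.
Proof.
rewrite /bourdon_metric; case: asboolP => [/end_of_inj zw|zw].
  by rewrite (visual_eq0 o z w).2.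
have {}zw : z <> w by move=> zw'; apply: zw; rewrite zw'.
by rewrite boundary_product_end_of // opprK lnK // posrE visual_gt0.
Qed.

Lemma crt_bourdon_metric_end_of o x y z w :
  crt (bourdon_metric o) (end_of x) (end_of y) (end_of z) (end_of w) =
  homog (r x y * r z w) (r x z * r y w) (r x w * r y z).
Proof.
have K0 z' : 0 < K (sval o) (z', 0) := join_radius_tree_point o _.
pose k t := (K (sval o) (t, 0))^-1.
have vE t s : crt_factor (bourdon_metric o) (end_of t) (end_of s) =
    (sval o).2 * r t s * k t * k s.
  rewrite /crt_factor bourdon_metric_end_of /= /visual (join_radius_ends rP).
  by rewrite invfM !mulrA.
pose c := (sval o).2 * (sval o).2 * (k x * k y * k z * k w).
rewrite /crt !vE -[RHS](@homogZ _ c).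
  by rewrite /c; congr homog; ring.
by rewrite gt_eqF // /c !mulr_gt0 ?radius_gt0 // invr_gt0.
Qed.

Lemma extended_metric_bourdon_metric o : extended_metric (bourdon_metric o).
Proof.
split.
- move=> x y; have [z <-] := end_of_surj x; have [w <-] := end_of_surj y.
  by rewrite bourdon_metric_end_of lee_fin visual_ge0.
- move=> x y; have [z <-] := end_of_surj x; have [w <-] := end_of_surj y.
  by rewrite !bourdon_metric_end_of visual_sym.
exists set0; split=> //; split=> [x y|x y|x y z] _ _.
- have [z <-] := end_of_surj x; have [w <-] := end_of_surj y.
  by rewrite bourdon_metric_end_of.
- have [z <-] := end_of_surj x; have [w <-] := end_of_surj y.
  rewrite bourdon_metric_end_of.
  split=> [[/(visual_eq0 o) ->//]|/end_of_inj zw].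
  by rewrite (visual_eq0 o z w).2.
- move=> _; have [x' <-] := end_of_surj x; have [y' <-] := end_of_surj y.
  have [z' <-] := end_of_surj z; rewrite !bourdon_metric_end_of -EFinD lee_fin.
  apply: (le_trans (visual_ultra o _ (y', 0) _)).
  by rewrite ge_max lerDl lerDr !visual_ge0.
Qed.

(** The Moebius map from the boundary to Z is the inverse of end_of. *)
Lemma ball_tree_moebius (M : set (Z -> Z -> \bar R)) :
  (forall rho, M rho -> forall x y z w, admissible x y z w ->
    crt rho x y z w = homog (r x y * r z w) (r x z * r y w) (r x w * r y z)) ->
  exists2 MX : set (boundary X -> boundary X -> \bar R),
    canonical_moebius_structure MX & moebius_equivalent MX M.
Proof.
move=> MP; case: ball_tree_inhabited => o.
exists [set rho | extended_metric rho /\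
  moebius_equivalent_metrics (bourdon_metric o) rho].
  split.
    by exists (bourdon_metric o) => //; exact: extended_metric_bourdon_metric.
  move=> b; split; first exact: extended_metric_bourdon_metric.
  move=> x y z w _.
  have [x' <-] := end_of_surj x; have [y' <-] := end_of_surj y.
  have [z' <-] := end_of_surj z; have [w' <-] := end_of_surj w.
  by rewrite !crt_bourdon_metric_end_of.
pose f b := sval (cid (end_of_surj b)).
have fK : cancel f end_of by move=> b; rewrite /f; case: cid.
have Kf : cancel end_of f by move=> z; apply: end_of_inj; rewrite fK.
exists f; first by exists end_of.
split; first exact: can_inj fK.
move=> rho rho' [_ rhoP] rho'M x y z w xyzw.
rewrite -(rhoP _ _ _ _ xyzw) -[in RHS](fK x) -[in RHS](fK y) -[in RHS](fK z)
  -[in RHS](fK w) crt_bourdon_metric_end_of; apply: MP => //.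
have fI := can_inj fK.
by case: xyzw => h1 h2 h3 h4; split=> -[/fI e1 /fI e2];
  [apply: h1|apply: h2|apply: h3|apply: h4].
Qed.

Lemma ball_tree_nonelementary : three_points Z -> nonelementary X.
Proof.
move=> [a [b [c [ab bc ac]]]]; exists (end_of a), (end_of b), (end_of c).
by split=> /end_of_inj.
Qed.

End Boundary.

(** * A representative with a remote point *)

Section Inversion.
Variables (R : realType) (Z : Type).
Implicit Types (rho : Z -> Z -> \bar R) (Om : set Z).

Lemma crt_factor_ge0 rho x y : (forall x y, 0 <= rho x y)%E ->
  0 <= crt_factor rho x y.
Proof.
move=> /(_ x y); rewrite /crt_factor.
by case: (rho x y).
Qed.

Lemma crt_factor_sym rho x y : (forall x y, rho x y = rho y x) ->
  crt_factor rho x y = crt_factor rho y x.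
Proof. by rewrite /crt_factor => ->. Qed.

Lemma crt_factorE rho Om x y : remote_set rho Om -> ~ Om x -> ~ Om y ->
  rho x y = (crt_factor rho x y)%:E.
Proof.
move=> [_ [fin _ _] _ _] x1 y1; have := fin _ _ x1 y1.
by rewrite /crt_factor; case: (rho x y).
Qed.

Lemma crt_factor_remote rho Om x w : remote_set rho Om -> ~ Om x -> Om w ->
  crt_factor rho x w = 1.
Proof. by move=> [_ _ inf _] x1 w1; rewrite /crt_factor inf. Qed.

Lemma crt_factor_eq0 rho Om x y : (forall x y, rho x y = rho y x) ->
  remote_set rho Om -> crt_factor rho x y = 0 <-> x = y.
Proof.
move=> sym rhoOm; have [Om1 [_ pos _] _ zero] := rhoOm.
have [x1|x1] := EM (Om x); have [y1|y1] := EM (Om y).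
- by rewrite (Om1 x y) // /crt_factor zero.
- rewrite crt_factor_sym // (crt_factor_remote rhoOm) //.
  by split=> [/eqP|xy]; [rewrite oner_eq0|rewrite -xy in y1].
- rewrite (crt_factor_remote rhoOm) //.
  by split=> [/eqP|xy]; [rewrite oner_eq0|rewrite -xy in y1].
rewrite -pos // (crt_factorE rhoOm) //.
by split=> [->|[]].
Qed.

Lemma crt_ultrametric rho x y z w : (forall x y, 0 <= rho x y)%E ->
  ultrametric_point (crt rho x y z w) ->
  crt_factor rho x z * crt_factor rho y w <=
  Num.max (crt_factor rho x y * crt_factor rho z w)
          (crt_factor rho x w * crt_factor rho y z).
Proof.
by move=> pos; apply: ultrametric_point_le; rewrite mulr_ge0 // crt_factor_ge0.
Qed.

(** The inversion of rho at om is rho x y / (rho x om * rho y om); it has remote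
    point om.  The weight of x is the factor 1 / rho x om, with value 1 at om,
    so that [crt_factor_inversion] holds at om too. *)
Definition inversion_weight rho (om x : Z) : R :=
  if `[< x = om >] then 1 else (crt_factor rho x om)^-1.

(** The inversion of rho at om, meant for rho without remote point. *)
Definition inversion rho (om x y : Z) : \bar R :=
  if `[< x = om >] || `[< y = om >] then if `[< x = y >] then 0%E else +oo%E
  else (crt_factor rho x y * inversion_weight rho om x *
    inversion_weight rho om y)%:E.

Lemma crt_factor_inversion rho om x y : extended_metric rho ->
  remote_set rho set0 ->
  crt_factor (inversion rho om) x y =
  crt_factor rho x y * inversion_weight rho om x * inversion_weight rho om y.
Proof.
move=> [_ sym _] rho0; rewrite [LHS]/crt_factor /inversion /inversion_weight.
have f0 u v : crt_factor rho u v = 0 <-> u = v by exact: crt_factor_eq0 rho0.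
have fN0 u v : u <> v -> crt_factor rho u v != 0.
  by move=> uv; apply/eqP => /f0.
case: (asboolP (x = om)) => [->|xom]; case: (asboolP (y = om)) => [->|yom] //=.
- by rewrite asboolT //= (f0 _ _).2 // !mul0r.
- rewrite asboolF; last exact: nesym.
  by rewrite mulr1 crt_factor_sym // mulfV // fN0.
- by rewrite asboolF // mulr1 mulfV // fN0.
Qed.

Lemma crt_inversion rho om x y z w : extended_metric rho ->
  remote_set rho set0 -> crt (inversion rho om) x y z w = crt rho x y z w.
Proof.
move=> rhoE rho0; have [_ sym _] := rhoE.
pose k t := inversion_weight rho om t.
have k0 t : k t != 0.
  rewrite /k /inversion_weight; case: asboolP => [_|tom].
    exact: oner_neq0.
  by rewrite invr_eq0; apply/eqP => /(crt_factor_eq0 _ _ sym rho0).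
rewrite /crt !crt_factor_inversion // -/(k x) -/(k y) -/(k z) -/(k w).
rewrite -[RHS](@homogZ _ (k x * k y * k z * k w)) ?mulf_neq0 //.
by congr homog; ring.
Qed.

Lemma extended_metric_inversion rho om : extended_metric rho ->
  remote_set rho set0 ->
  (forall x y z w, admissible x y z w -> ultrametric_point (crt rho x y z w)) ->
  extended_metric (inversion rho om) /\ remote_set (inversion rho om) [set om].
Proof.
move=> rhoE rho0 ult; have [pos sym _] := rhoE.
have f0 u v : crt_factor rho u v = 0 <-> u = v by exact: crt_factor_eq0 rho0.
have w0 t : 0 < inversion_weight rho om t.
  rewrite /inversion_weight; case: asboolP => // tom.
  rewrite invr_gt0 lt_neqAle crt_factor_ge0 // andbT eq_sym.
  by apply/eqP => /f0.
have off x y : x <> om -> y <> om -> inversion rho om x y =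
    (crt_factor rho x y * inversion_weight rho om x *
     inversion_weight rho om y)%:E.
  by move=> xom yom; rewrite /inversion (asboolF xom) (asboolF yom).
have rem : remote_set (inversion rho om) [set om].
  split=> [x y -> ->//||z w zom ->|w ->].
  - split=> [x y xom yom|x y xom yom|x y z xom yom zom].
    + by rewrite off.
    + rewrite off // -f0; split=> [[] /eqP|->]; last by rewrite !mul0r.
      by rewrite !mulf_eq0 !(gt_eqF (w0 _)) !orbF => /eqP.
    + rewrite !off // -EFinD lee_fin.
      (* The ultrametric inequality comes from the cross ratio triple of
         (x, y, z, om), which is admissible unless x = y = z. *)
      have [[xy yz]|xyz] := EM (x = y /\ y = z).
        rewrite -yz -xy (f0 x x).2 // !mul0r addr0 //.
      have adm : admissible x y z om by split=> // -[].
      have := crt_ultrametric pos (ult _ _ _ _ adm).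
      set a := inversion_weight rho om x; set b := inversion_weight rho om y.
      set c := inversion_weight rho om z.
      have [ax by_ cz] : [/\ crt_factor rho x om = a^-1,
        crt_factor rho y om = b^-1 & crt_factor rho z om = c^-1].
        by rewrite /a /b /c /inversion_weight !asboolF ?invrK.
      have [a0 b0 c0] : [/\ 0 < a, 0 < b & 0 < c] by split; exact: w0.
      rewrite ax by_ cz => h.
      have abc0 := ltW (mulr_gt0 (mulr_gt0 a0 b0) c0).
      have {h} := ler_wpM2r abc0 h.
      rewrite (maxr_pMl _ _ abc0) le_max.
      have p t s : 0 <= crt_factor rho t s by exact: crt_factor_ge0.
      have P1 := mulr_ge0 (mulr_ge0 (p x y) (ltW a0)) (ltW b0).
      have P2 := mulr_ge0 (mulr_ge0 (p y z) (ltW b0)) (ltW c0).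
      have e1 : crt_factor rho x z / b * (a * b * c) =
          crt_factor rho x z * a * c.
        by field; rewrite gt_eqF.
      have e2 : crt_factor rho x y / c * (a * b * c) =
          crt_factor rho x y * a * b.
        by field; rewrite gt_eqF.
      have e3 : a^-1 * crt_factor rho y z * (a * b * c) =
          crt_factor rho y z * b * c.
        by field; rewrite gt_eqF.
      by rewrite e1 e2 e3 => /orP[]; lra.
  - by rewrite /inversion [`[< om = om >]]asboolT // orbT asboolF.
  - by rewrite /inversion !asboolT.
split=> //; split; last by exists [set om].
- move=> x y; rewrite /inversion; case: ifP => _; first by case: ifP.
  by rewrite lee_fin !mulr_ge0 ?crt_factor_ge0 // ltW.
- move=> x y; rewrite /inversion orbC crt_factor_sym // mulrAC.
  by have -> : `[< x = y >] = `[< y = x >] by apply/asbool_equiv_eq; split.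
Qed.

Lemma moebius_remote_representative (M : set (Z -> Z -> \bar R)) :
  moebius_space M -> ultrametric_moebius M ->
  exists rho om, [/\ M rho, remote_set rho [set om] &
    forall rho', M rho' -> moebius_equivalent_metrics rho' rho].
Proof.
move=> [[a [b [c _]]] [rho rhoE ME]] ult.
have Mrho : M rho by rewrite ME.
have [Om rhoOm] : exists Om, remote_set rho Om by case: rhoE.
have [[om omP]|noOm] := EM (exists om, Om om).
  exists rho, om; split=> //; last first.
    by move=> rho'; rewrite ME => -[_ h] x y z w adm; rewrite h.
  suff <- : Om = [set om] by [].
  apply/seteqP; split=> [x xOm|x ->//]; case: rhoOm => + _ _ _.
  by apply.
have Om0 : Om = set0 by apply/seteqP; split=> // x xOm; apply: noOm; exists x.
rewrite Om0 in rhoOm.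
have [invE invOm] := extended_metric_inversion a rhoE rhoOm (ult rho Mrho).
exists (inversion rho a), a; split=> //.
  by rewrite ME; split=> // x y z w _; rewrite crt_inversion.
by move=> rho'; rewrite ME => -[_ h] x y z w adm; rewrite crt_inversion // h.
Qed.

Lemma crt_factor_remote_ultrametric rho om : three_points Z ->
  extended_metric rho -> remote_set rho [set om] ->
  (forall x y z w, admissible x y z w -> ultrametric_point (crt rho x y z w)) ->
  remote_ultrametric (crt_factor rho) om.
Proof.
move=> [a [b [c [ab _ _]]]] [pos sym _] rem ult.
split.
- by move=> x y; exact: crt_factor_ge0.
- by move=> x y; exact: crt_factor_sym.
- by move=> x y; exact: crt_factor_eq0 rem.
- by move=> x xom; exact: (crt_factor_remote rem).
- move=> x y z xom yom zom.
  have [[xy yz]|xyz] := EM (x = y /\ y = z).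
    by rewrite -yz -xy maxxx.
  have adm : admissible x y z om by split=> // -[].
  have := crt_ultrametric pos (ult _ _ _ _ adm).
  by rewrite !(crt_factor_remote (w := om) rem) // !mulr1 mul1r.
have [aom|aom] := EM (a = om); last by exists a.
by exists b => bom; apply: ab; rewrite aom.
Qed.

Lemma crt_factor_remote_complete rho om : remote_set rho [set om] ->
  complete_extended_metric rho -> remote_complete (crt_factor rho) om.
Proof.
move=> rem /(_ _ rem)[cpl _] u uom uC.
have [|l lom lP] := cpl u.
  split=> // e /uC[N NP]; exists N => m n Nm Nn.
  by rewrite (crt_factorE rem) ?lte_fin ?NP //; exact: uom.
exists l => // e /lP[N NP]; exists N => n /NP.
by rewrite (crt_factorE rem) ?lte_fin //; exact: uom.
Qed.

End Inversion.

Theorem theorem4p1 (R : realType) (Z : Type) (M : set (Z -> Z -> \bar R)) :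
  moebius_space M -> complete_moebius M -> ultrametric_moebius M ->
  exists X : metricType R,
    [/\ is_tree X, geodesically_complete X, nonelementary X &
      exists2 MX : set (boundary X -> boundary X -> \bar R),
        canonical_moebius_structure MX & moebius_equivalent MX M].
Proof.
move=> MZ Mcpl Mult.
have [rho [om [Mrho rem Meq]]] := moebius_remote_representative MZ Mult.
have [Z3 [rho0 _ ME]] := MZ.
have rhoE : extended_metric rho by move: Mrho; rewrite ME => -[].
have rP := crt_factor_remote_ultrametric Z3 rhoE rem (Mult _ Mrho).
have rC := crt_factor_remote_complete rem (Mcpl _ Mrho).
exists (ball_tree rP).
have hyp := @ball_tree_zero_hyperbolic _ _ _ _ rP.
split.
- exact: zero_hyperbolic_is_tree hyp (@ball_tree_geodesic_space _ _ _ _ rP).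
- apply: ray_extendable_geodesically_complete hyp _.
  exact: ball_tree_ray_extendable.
- exact: ball_tree_nonelementary.
- by apply: ball_tree_moebius => // rho' /Meq; exact.
Qed.
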